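(* Let $\gamma\in[0,1]$ and let $\mathcal{N}$ be the single-qubit amplitude-damping channel with Kraus operators $$K_1=\begin{pmatrix}1&0\\0&\sqrt{1-\gamma}\end{pmatrix},\qquad K_2=\begin{pmatrix}0&\sqrt\gamma\\0&0\end{pmatrix}.$$ Then the Kraus decomposition $K^{(U)}_{i'}=\sum_{i=1}^2U_{i'i}K_i$, $i'\in\{1,2\}$, with $$U=\frac{1}{\sqrt2}\begin{pmatrix}1&1\\1&-1\end{pmatrix}$$ is optimal for the Choi state of $\mathcal{N}$.
   Context: Let $|\omega\rangle=\frac1{\sqrt2}(|00\rangle+|11\rangle)$ and let $\mathrm{C}(\mathcal{N})=(\mathcal{N}\otimes\mathcal{I})[|\omega\rangle\langle\omega|]$ be the Choi state of a single-qubit channel $\mathcal{N}$. A Kraus decomposition $\{K_i\}_i$ of $\mathcal{N}$ induces the ensemble decomposition $\{p_i,|\phi_i\rangle\}_i$ of $\mathrm{C}(\mathcal{N})$ with $p_i=\|(K_i\otimes\mathbb{1})|\omega\rangle\|_2^2$ and $|\phi_i\rangle=p_i^{-1/2}(K_i\otimes\mathbb{1})|\omega\rangle$. It is called optimal for the Choi state if $\sum_ip_iE(|\phi_i\rangle)=E_{\mathrm{oF}}(\mathrm{C}(\mathcal{N}))$, where $E(|\phi\rangle)=-\mathrm{Tr}[\rho_A\log_2\rho_A]$ ($\rho_A$ the reduced state on the first qubit) and the entanglement of formation $E_{\mathrm{oF}}(\rho)$ is the infimum of $\sum_iq_iE(|\varphi_i\rangle)$ over all pure-state ensemble decompositions $\rho=\sum_iq_i|\varphi_i\rangle\langle\varphi_i|$.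 *)

(* Defs.v *)
From HB Require Import structures.
From mathcomp Require Import all_boot all_order all_algebra.
From mathcomp Require Import complex mxtens.
From mathcomp Require Import classical_sets reals exp.

Set Implicit Arguments.
Unset Strict Implicit.
Unset Printing Implicit Defensive.

Import Order.TTheory GRing.Theory Num.Theory.
Local Open Scope ring_scope.
Local Open Scope complex_scope.
Local Open Scope classical_set_scope.

(* Bipartite systems: 'I_(m * n) is identified with 'I_m * 'I_n through
   [mxtens_index], the convention of the Kronecker product [*t]; the first
   factor is the system A. *)

Section States.
Variable R : realType.
Local Notation C := R[i].

Definition adjmx m n (A : 'M[C]_(m, n)) : 'M[C]_(n, m) := (A ^t*)%sesqui.

Definition sqnorm n (v : 'cV[C]_n) : R := \sum_(i < n) ComplexField.Normc.normc (v i 0) ^+ 2.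

Definition projector n (v : 'cV[C]_n) : 'M[C]_n := v *m adjmx v.

Definition ptraceB m n (X : 'M[C]_(m * n)) : 'M[C]_m :=
  \matrix_(a, a') \sum_(b < n) X (mxtens_index (a, b)) (mxtens_index (a', b)).

Definition log2 (x : R) : R := ln x / ln 2.

(* Functional calculus, meaningful for Hermitian positive semidefinite A, whose
   eigenvalues are real. As [ln 0 = 0], zero eigenvalues are sent to 0, which
   implements the convention 0 log 0 = 0 in [vn_entropy]. *)
Definition log2mx n (A : 'M[C]_n) : 'M[C]_n :=
  invmx (spectralmx A)
    *m diag_mx (map_mx (fun z : C => (log2 (complex.Re z))%:C) (spectral_diag A))
    *m spectralmx A.

(* The trace is a real number when rho is Hermitian positive semidefinite. *)
Definition vn_entropy n (rho : 'M[C]_n) : R :=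
  - complex.Re (\tr (rho *m log2mx rho)).

Definition entanglement m n (phi : 'cV[C]_(m * n)) : R :=
  vn_entropy (ptraceB (projector phi)).

Definition pure_ensemble d k (q : 'I_k -> R) (phi : 'I_k -> 'cV[C]_d)
    (rho : 'M[C]_d) : Prop :=
  [/\ forall i, 0 <= q i,
      \sum_(i < k) q i = 1,
      forall i, sqnorm (phi i) = 1 &
      rho = \sum_(i < k) (q i)%:C *: projector (phi i)].

(* For a density matrix rho the set is nonempty (spectral decomposition) and
   bounded below by 0, so that [inf] is its genuine infimum. *)
Definition EoF m n (rho : 'M[C]_(m * n)) : R :=
  inf [set e : R | exists k (q : 'I_k -> R) (phi : 'I_k -> 'cV[C]_(m * n)),
         pure_ensemble q phi rho /\
         e = \sum_(i < k) q i * entanglement (phi i)].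

End States.

Section QubitChannels.
Variable R : realType.
Local Notation C := R[i].

Definition kraus_map k (K : 'I_k -> 'M[C]_2) (rho : 'M[C]_2) : 'M[C]_2 :=
  \sum_(i < k) K i *m rho *m adjmx (K i).

Definition kraus_decomposition k (K : 'I_k -> 'M[C]_2)
    (N : 'M[C]_2 -> 'M[C]_2) : Prop :=
  \sum_(i < k) adjmx (K i) *m K i = 1%:M /\ N =1 kraus_map K.

(* N (x) I, computed from X = \sum_(b, b') X_(b, b') (x) |b><b'|. *)
Definition tens_id (N : 'M[C]_2 -> 'M[C]_2) (X : 'M[C]_(2 * 2)) :
    'M[C]_(2 * 2) :=
  \sum_(b < 2) \sum_(b' < 2)
    N (\matrix_(a, a') X (mxtens_index (a, b)) (mxtens_index (a', b')))
      *t delta_mx b b'.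

Definition ket (i : 'I_2) : 'cV[C]_2 := delta_mx i 0.

Definition omega : 'cV[C]_(2 * 2) :=
  (Num.sqrt (2 : R))^-1%:C *: (ket 0 *t ket 0 + ket 1 *t ket 1).

Definition choi (N : 'M[C]_2 -> 'M[C]_2) : 'M[C]_(2 * 2) :=
  tens_id N (projector omega).

Definition kraus_vec (K : 'M[C]_2) : 'cV[C]_(2 * 2) :=
  (K *t (1%:M : 'M[C]_2)) *m omega.

Definition kraus_prob (K : 'M[C]_2) : R := sqnorm (kraus_vec K).

(* When [kraus_prob K = 0] this is the zero vector; it then carries weight 0 in
   [choi_optimal]. *)
Definition kraus_state (K : 'M[C]_2) : 'cV[C]_(2 * 2) :=
  (Num.sqrt (kraus_prob K))^-1%:C *: kraus_vec K.

Definition choi_optimal k (K : 'I_k -> 'M[C]_2) (N : 'M[C]_2 -> 'M[C]_2) :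
    Prop :=
  \sum_(i < k) kraus_prob (K i) * entanglement (kraus_state (K i))
    = EoF (choi N).

Definition mx2 (a b c d : C) : 'M[C]_2 :=
  \matrix_(i, j) if i == 0 then (if j == 0 then a else b)
                 else (if j == 0 then c else d).

Definition amp_damp_kraus (gamma : R) (i : 'I_2) : 'M[C]_2 :=
  if i == 0 then mx2 1 0 0 (Num.sqrt (1 - gamma))%:C
  else mx2 0 (Num.sqrt gamma)%:C 0 0.

Definition amp_damp (gamma : R) : 'M[C]_2 -> 'M[C]_2 :=
  kraus_map (amp_damp_kraus gamma).

Definition kraus_mix k (U : 'M[C]_k) (K : 'I_k -> 'M[C]_2) (i' : 'I_k) :
    'M[C]_2 :=
  \sum_(i < k) U i' i *: K i.

End QubitChannels.

(* Main.v *)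
Require Import Defs.
From mathcomp Require Import all_boot all_order all_algebra.
From mathcomp Require Import complex mxtens.
From mathcomp Require Import boolp classical_sets reals topology normedtype.
From mathcomp Require Import derive realfun exp.
From mathcomp Require Import ring lra.

(* Write a two-qubit vector as a 2x2 matrix, so that its reduced state has the
   determinant |det|^2. A vector in the range of the Choi state has
   <10|phi> = 0 and <11|phi> = sqrt(1 - gamma) <00|phi>, hence
   |det phi| = sqrt(1 - gamma) |<00|phi>|^2, and the average of |det| over any
   ensemble is the constant sqrt(1 - gamma) <00|C(N)|00> = sqrt(1 - gamma) / 2.
   As the entanglement is a convex function of |det|, Jensen's inequality
   bounds every ensemble average from below by the entanglement at that
   constant. Both states of the Hadamard-mixed decomposition have |det| equal
   to it, so they attain the bound. *)

Set Implicit Arguments.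
Unset Strict Implicit.
Unset Printing Implicit Defensive.

Import Order.TTheory GRing.Theory Num.Theory.
Import numFieldNormedType.Exports.
Import ComplexField.
Local Open Scope ring_scope.
Local Open Scope complex_scope.

(** * Convexity of the entropy as a function of the concurrence *)

Lemma ge0_is_derive_le (R : realType) (f df : R -> R) (a b : R) : a <= b ->
  (forall x, a <= x <= b -> is_derive x 1 f (df x)) ->
  (forall x, a <= x <= b -> 0 <= df x) -> f a <= f b.
Proof.
move=> ab fdf df_ge0.
have [x||c] := @MVT_segment R f df a b ab.
- by rewrite in_itv/= => /andP[ax xb]; apply: fdf; rewrite !ltW.
- apply: derivable_within_continuous => x; rewrite in_itv/= => xab.
  by have [] := fdf _ xab.
rewrite in_itv/= => cab fE; rewrite -subr_ge0 fE mulr_ge0 ?subr_ge0//.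
exact: df_ge0.
Qed.

Lemma is_derive_div (R : realType) (f g : R -> R) (x df dg : R) :
  is_derive x 1 f df -> is_derive x 1 g dg -> g x != 0 ->
  is_derive x 1 (fun y => f y / g y) ((df * g x - f x * dg) / g x ^+ 2).
Proof.
move=> [fd fE] [gd gE] gx0.
have dV : is_derive x 1 (fun y => (g y)^-1) (- (g x) ^- 2 * dg).
  by apply: DeriveDef; [exact: derivableV|rewrite deriveV// gE].
have dM := is_deriveM (DeriveDef fd fE) dV.
by apply: (is_derive_eq dM); rewrite /GRing.scale/=; field.
Qed.

Lemma is_derive_sqr (R : realType) (x : R) :
  is_derive x 1 (fun y : R => y ^+ 2) (2 * x).
Proof.
apply: (is_derive_eq (is_deriveM (is_derive_id x 1) (is_derive_id x 1))).
by rewrite /GRing.scale/=; ring.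
Qed.

Lemma is_derive_1Dsqr (R : realType) (x : R) :
  is_derive x 1 (fun y : R => 1 + y ^+ 2) (2 * x).
Proof.
by have d := is_deriveD (is_derive_cst (1 : R) x 1) (is_derive_sqr x); rewrite add0r in d.
Qed.

Lemma is_derive_1Bsqr (R : realType) (x : R) :
  is_derive x 1 (fun y : R => 1 - y ^+ 2) (- (2 * x)).
Proof.
by have d := is_deriveB (is_derive_cst (1 : R) x 1) (is_derive_sqr x); rewrite sub0r in d.
Qed.

(** After division by [1 + x ^+ 2] the left side is [f x], where [f] vanishes at 1 and has the
    nonnegative derivative [df]. This expression controls the sign of the derivative of [slope]. *)
Lemma ln_le_ratio (R : realType) (x : R) : 0 < x -> x <= 1 ->
  (1 + x ^+ 2) * ln x + (1 - x ^+ 2) <= 0.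
Proof.
move=> x0 x1.
pose f (y : R) := ln y + (1 - y ^+ 2) / (1 + y ^+ 2).
pose df (y : R) := (1 - y ^+ 2) ^+ 2 / (y * (1 + y ^+ 2) ^+ 2).
have : f x <= f 1.
  apply: (@ge0_is_derive_le R f df) => // y /andP[xy y1].
    have y0 : 0 < y by lra.
    have y20 : 1 + y ^+ 2 != 0 by apply: lt0r_neq0; nra.
    apply: (is_derive_eq (is_deriveD (is_derive1_ln y0)
      (is_derive_div (is_derive_1Bsqr y) (is_derive_1Dsqr y) y20))).
    by rewrite /df; field; rewrite y20 lt0r_neq0.
  have y0 : 0 < y by lra.
  by rewrite divr_ge0 ?sqr_ge0// mulr_ge0 ?sqr_ge0// ltW.
have p : 0 < 1 + x ^+ 2 by nra.
rewrite /f ln1 expr1n subrr mul0r addr0 -(ler_pM2l p) mulr0 mulrDr.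
by rewrite mulrCA divff ?mulr1// gt_eqF.
Qed.

(* The entropy (in nats) and the concurrence of a qubit state with eigenvalues
   [1 / (1 + x^2)] and [x^2 / (1 + x^2)], and the derivative of the former with
   respect to the latter. [slope 1] is the junk value 0; the limit there is 1. *)
Definition ent_ratio (R : realType) (x : R) : R :=
  ln (1 + x ^+ 2) - 2 * (x ^+ 2 * ln x) / (1 + x ^+ 2).

Definition conc_ratio (R : realType) (x : R) : R := 2 * x / (1 + x ^+ 2).

Definition slope (R : realType) (x : R) : R := - (2 * (x * ln x)) / (1 - x ^+ 2).

Lemma is_derive_xln (R : realType) (x : R) : 0 < x ->
  is_derive x 1 (fun y : R => y * ln y) (ln x + 1).
Proof.
move=> x0.
apply: (is_derive_eq (is_deriveM (is_derive_id x 1) (is_derive1_ln x0))).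
by rewrite /GRing.scale/=; field; rewrite gt_eqF.
Qed.

Lemma is_derive_N2xln (R : realType) (x : R) : 0 < x ->
  is_derive x 1 (fun y : R => - (2 * (y * ln y))) (- (2 * (ln x + 1))).
Proof. by move=> x0; exact: (is_deriveN (is_deriveZ 2 (is_derive_xln x0))). Qed.

(** This monotonicity is the convexity of the entropy in the concurrence. The numerator of the
    derivative is [-2] times the expression that [ln_le_ratio] shows to be nonpositive. *)
Lemma slope_incr (R : realType) (x y : R) : 0 < x -> x <= y -> y < 1 ->
  slope x <= slope y.
Proof.
move=> x0 xy y1.
pose df (z : R) := - 2 * ((1 + z ^+ 2) * ln z + (1 - z ^+ 2)) / (1 - z ^+ 2) ^+ 2.
apply: (@ge0_is_derive_le R _ df) => // z /andP[xz zy].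
  have z0 : 0 < z by lra.
  have z20 : 1 - z ^+ 2 != 0 by apply: lt0r_neq0; nra.
  apply: (is_derive_eq (is_derive_div
    (is_derive_N2xln z0) (is_derive_1Bsqr z) z20)).
  by rewrite /df; field.
have z0 : 0 < z by lra.
have z1 : z <= 1 by lra.
have h := ln_le_ratio z0 z1.
by rewrite /df divr_ge0 ?sqr_ge0// mulNr oppr_ge0 pmulr_rle0.
Qed.

(** With the denominator cleared, the difference [g] vanishes at 1, and its derivative
    [-2 (ln z + 1 - z)] is nonnegative because [ln z <= z - 1]. The bound replaces [slope_incr] at
    the end point 1. *)
Lemma slope_le1 (R : realType) (x : R) : 0 < x -> x < 1 -> slope x <= 1.
Proof.
move=> x0 x1; pose df (z : R) := - 2 * (ln z + 1 - z).
rewrite /slope ler_pdivrMr; last by nra.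
rewrite mul1r -subr_ge0 -opprB oppr_ge0.
pose g := (fun z : R => - (2 * (z * ln z)) - (1 - z ^+ 2)).
have : g x <= g 1.
  apply: (@ge0_is_derive_le R _ df); [exact: ltW| |] => z /andP[xz z1].
    have z0 : 0 < z by lra.
    apply: (is_derive_eq (is_deriveB (is_derive_N2xln z0) (is_derive_1Bsqr z))).
    by rewrite /df; ring.
  have z0 : 0 < z by lra.
  have : ln (1 + (z - 1)) <= z - 1 by apply: le_ln1Dx; lra.
  rewrite addrC subrK /df; lra.
by rewrite /g ln1 expr1n; lra.
Qed.

Lemma is_derive_tangent (R : realType) (m x : R) : 0 < x ->
  is_derive x 1 (fun y => ent_ratio y - m * conc_ratio y)
    (2 * (- (2 * (x * ln x)) - m * (1 - x ^+ 2)) / (1 + x ^+ 2) ^+ 2).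
Proof.
move=> x0.
have D0 (y : R) : 0 < 1 + y ^+ 2 by have := sqr_ge0 y; lra.
have dl : is_derive x 1 (fun y : R => ln (1 + y ^+ 2)) ((1 + x ^+ 2)^-1 * (2 * x)).
  exact: (@is_derive1_comp _ (@ln R) (fun y : R => 1 + y ^+ 2) x _ _
    (is_derive1_ln (D0 x)) (is_derive_1Dsqr x)).
have dn : is_derive x 1 (fun y : R => 2 * (y * (y * ln y)))
    (2 * (x * (ln x + 1) + x * ln x * 1)).
  exact: (is_deriveZ 2 (is_deriveM (is_derive_id x 1) (is_derive_xln x0))).
have dm : is_derive x 1 (fun y : R => 2 * y) (2 * 1).
  exact: (is_deriveZ 2 (is_derive_id x 1)).
have dq := is_derive_div dn (is_derive_1Dsqr x) (lt0r_neq0 (D0 x)).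
have dc := is_derive_div dm (is_derive_1Dsqr x) (lt0r_neq0 (D0 x)).
have d := is_deriveB (is_deriveB dl dq) (is_deriveZ m dc).
have -> : (fun y => ent_ratio y - m * conc_ratio y) = (fun y : R => ln (1 + y ^+ 2) -
   (2 * (y * (y * ln y))) / (1 + y ^+ 2) - m * (2 * y / (1 + y ^+ 2))).
  by apply/funext => y; rewrite /ent_ratio /conc_ratio (mulrA y y) -expr2.
apply: (is_derive_eq d); rewrite /GRing.scale/=.
by have := lt0r_neq0 (D0 x) => ?; field.
Qed.

Lemma ent_ratio_ge0 (R : realType) (x : R) : 0 <= x <= 1 -> 0 <= ent_ratio x.
Proof.
move=> /andP[x0 x1]; have D0 : 0 < 1 + x ^+ 2 by have := sqr_ge0 x; lra.
rewrite /ent_ratio addr_ge0//; first by rewrite ln_ge0// lerDl sqr_ge0.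
rewrite -mulNr divr_ge0 ?(ltW D0)// oppr_ge0 pmulr_rle0// mulr_ge0_le0 ?sqr_ge0//.
exact: ln_le0.
Qed.

(** The tangent at parameter [x] passes below the origin of the concurrence-entropy plane, which is
    the curve point of parameter 0. The difference splits into two terms, each nonnegative by
    [ln (1 + t) <= t]. *)
Lemma ratio_tangent0 (R : realType) (x : R) : 0 < x -> x < 1 ->
  ent_ratio x <= slope x * conc_ratio x.
Proof.
move=> x0 x1; have D0 : 0 < 1 + x ^+ 2 by have := sqr_ge0 x; lra.
have D1 : 0 < 1 - x ^+ 2 by nra.
have l1 : ln (1 + x ^+ 2) <= x ^+ 2 by apply: le_ln1Dx; nra.
have l2 : 2 * ln x <= x ^+ 2 - 1.
  rewrite mulr_natl -lnXn//.
  have : ln (1 + (x ^+ 2 - 1)) <= x ^+ 2 - 1 by apply: le_ln1Dx; nra.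
  by rewrite addrC subrK.
rewrite -subr_ge0 /ent_ratio /slope /conc_ratio.
set L := ln x; rewrite -/L in l2.
have -> : - (2 * (x * L)) / (1 - x ^+ 2) * (2 * x / (1 + x ^+ 2)) -
  (ln (1 + x ^+ 2) - 2 * (x ^+ 2 * L) / (1 + x ^+ 2)) =
  x ^+ 2 * (x ^+ 2 - 1 - 2 * L) / (1 - x ^+ 2) + (x ^+ 2 - ln (1 + x ^+ 2)).
  by field; rewrite !gt_eqF.
by rewrite addr_ge0 ?subr_ge0// divr_ge0 ?(ltW D1)// mulr_ge0 ?sqr_ge0// subr_ge0.
Qed.

(** Convexity is stated as the existence of a supporting line, the form in which Jensen's inequality
    uses it. It suffices that [ent_ratio - m * conc_ratio] decreases up to [x0] and increases
    afterwards. *)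
Lemma ratio_tangent (R : realType) (x0 : R) : 0 <= x0 <= 1 ->
  exists m, forall x, 0 <= x <= 1 ->
    ent_ratio x0 + m * (conc_ratio x - conc_ratio x0) <= ent_ratio x.
Proof.
have e0 : ent_ratio (0 : R) = 0.
  by rewrite /ent_ratio expr0n/= !(mul0r, mulr0, addr0) ln1 subr0.
move=> /andP[]; rewrite le_eqVlt => /orP[/eqP<- _|x0_gt0 x0_le1].
  (* At [x0 = 0] entropy and concurrence both vanish, so a horizontal line supports the curve. *)
  by exists 0 => x /ent_ratio_ge0; rewrite mul0r addr0 e0.
have c0 : conc_ratio (0 : R) = 0 by rewrite /conc_ratio mulr0 mul0r.
(* The derivative of [ent_ratio - m * conc_ratio] has the sign of
   [- 2 z ln z - m (1 - z ^ 2)]; it does not cover the end point [z = 0]. *)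
suff [m [mle mge mt]] : exists m, [/\
    forall z, 0 < z -> z <= x0 -> - (2 * (z * ln z)) - m * (1 - z ^+ 2) <= 0,
    forall z, x0 <= z -> z <= 1 -> 0 <= - (2 * (z * ln z)) - m * (1 - z ^+ 2) &
    ent_ratio x0 <= m * conc_ratio x0].
  exists m => x /andP[]; rewrite le_eqVlt => /orP[/eqP<- _|x_gt0 x_le1].
    by rewrite e0 c0 sub0r mulrN subr_le0.
  suff : ent_ratio x0 - m * conc_ratio x0 <= ent_ratio x - m * conc_ratio x by lra.
  have [x0x|/ltW xx0] := leP x0 x.
    apply: (@ge0_is_derive_le R (fun y => ent_ratio y - m * conc_ratio y) _ _ _ x0x)
      => z /andP[x0z zx].
      by apply: is_derive_tangent; lra.
    by rewrite divr_ge0 ?sqr_ge0// mulr_ge0// mge//; lra.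
  rewrite -lerN2.
  apply: (@ge0_is_derive_le R (fun y => - (ent_ratio y - m * conc_ratio y)) _ _ _ xx0)
    => z /andP[xz zx0].
    have z0 : 0 < z by lra.
    exact: (is_deriveN (is_derive_tangent m z0)).
  rewrite oppr_ge0 -mulrA pmulr_rle0// pmulr_lle0 ?mle//; first by lra.
  by rewrite invr_gt0 exprn_gt0//; have := sqr_ge0 z; lra.
have slopeK (z : R) : z < 1 -> 0 < z ->
    0 < 1 - z ^+ 2 /\ - (2 * (z * ln z)) = slope z * (1 - z ^+ 2).
  move=> z1 z0; have D1 : 0 < 1 - z ^+ 2 by nra.
  by split; rewrite // /slope divfK// gt_eqF.
have [x0_1|x0_1] := ltP x0 1.
  exists (slope x0); split.
  - move=> z z0 zx0; have [|D1 ->] := slopeK z _ z0; first by lra.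
    by rewrite -mulrBl pmulr_lle0// subr_le0 slope_incr.
  - move=> z x0z; rewrite le_eqVlt => /orP[/eqP->|z1].
      by rewrite ln1 expr1n subrr !mulr0 oppr0 addr0.
    have [||D1 ->] := slopeK z; rewrite //; first by lra.
    by rewrite -mulrBl pmulr_lge0// subr_ge0 slope_incr.
  - exact: ratio_tangent0.
have {x0_le1 x0_1}-> : x0 = 1 by lra.
(* At the maximally entangled end point the limit of [slope] is taken, since [slope 1] is a default
   value. *)
exists 1; split.
- move=> z z0; rewrite le_eqVlt => /orP[/eqP->|z1].
    by rewrite ln1 expr1n subrr !mulr0 oppr0 addr0.
  have [||D1 ->] := slopeK z; rewrite //.
  by rewrite -mulrBl pmulr_lle0// subr_le0 slope_le1.
- move=> z z1 z1'; have -> : z = 1 by lra.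
  by rewrite ln1 expr1n subrr !mulr0 oppr0 addr0.
- rewrite /ent_ratio /conc_ratio ln1 expr1n !mulr0 mul0r subr0 mulr1 mul1r.
  by rewrite divff ?pnatr_eq0//; have := @le_ln1Dx R 1; lra.
Qed.

Definition bin_ent (R : realType) (a b : R) : R := - (a * ln a + b * ln b).

Lemma bin_ent_ratio (R : realType) (a b : R) : 0 <= b -> b <= a -> a + b = 1 ->
  exists x, [/\ 0 <= x <= 1, bin_ent a b = ent_ratio x &
     2 * Num.sqrt (a * b) = conc_ratio x].
Proof.
move=> b0 ba ab1.
have a0 : 0 < a by lra.
have ba_ge0 : 0 <= b / a by rewrite divr_ge0// ltW.
(* The parameter is the ratio of the Schmidt coefficients, so that [a = 1 / (1 + x^2)]; it is at
   most 1 because [b <= a]. *)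
exists (Num.sqrt (b / a)).
have xE : 1 + Num.sqrt (b / a) ^+ 2 = a^-1.
  by rewrite sqr_sqrtr// (_ : b = 1 - a); [field; rewrite gt_eqF|lra].
split.
- rewrite sqrtr_ge0 -[leRHS]sqrtr1 ler_sqrt ?ler01//.
  by rewrite ler_pdivrMr ?mul1r.
- rewrite /ent_ratio xE invrK sqr_sqrtr// /bin_ent.
  have [b_eq0|b_neq0] := eqVneq b 0.
    have -> : a = 1 by lra.
    by rewrite b_eq0 invr1 ln1 !(mul0r, mulr0, oppr0, addr0).
  have b_gt0 : 0 < b by rewrite lt_neqAle eq_sym b_neq0.
  have : ln (Num.sqrt (b / a) ^+ 2) = 2 * ln (Num.sqrt (b / a)).
    by rewrite lnXn ?mulr_natl// sqrtr_gt0 divr_gt0.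
  rewrite sqr_sqrtr// ln_div ?posrE// => lE.
  rewrite (_ : 2 * (b / a * ln _) = b / a * (ln b - ln a)); last by rewrite lE; ring.
  rewrite lnV ?posrE//.
  have -> : a = 1 - b by lra.
  have : 1 - b != 0 by rewrite gt_eqF//; lra.
  by move=> ?; field.
- rewrite /conc_ratio xE invrK -mulrA; congr (2 * _).
  have -> : a * b = (b / a) * a ^+ 2 by field; rewrite gt_eqF.
  by rewrite sqrtrM// sqrtr_sqr gtr0_norm.
Qed.

(* [2 * sqrt (a * b)] is the concurrence of a pure state with Schmidt weights
   [a] and [b]. *)
Lemma bin_ent_tangent (R : realType) (a0 b0 : R) :
  0 <= a0 -> 0 <= b0 -> a0 + b0 = 1 ->
  exists m, forall a b, 0 <= a -> 0 <= b -> a + b = 1 ->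
    bin_ent a0 b0 + m * (2 * Num.sqrt (a * b) - 2 * Num.sqrt (a0 * b0))
      <= bin_ent a b.
Proof.
have ratio (a b : R) : 0 <= a -> 0 <= b -> a + b = 1 ->
    exists x, [/\ 0 <= x <= 1, bin_ent a b = ent_ratio x &
     2 * Num.sqrt (a * b) = conc_ratio x].
  move=> a_ge0 b_ge0 ab1; have [ba|/ltW ab] := leP b a.
    exact: bin_ent_ratio.
  rewrite /bin_ent addrC (mulrC a b); apply: bin_ent_ratio => //.
  by rewrite addrC.
move=> ha0 hb0 hab0; have [x0 [x0_01 -> ->]] := ratio _ _ ha0 hb0 hab0.
have [m mP] := ratio_tangent x0_01; exists m => a b ha hb hab.
by have [x [x_01 -> ->]] := ratio _ _ ha hb hab; exact: mP.
Qed.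

(** * Entanglement of two-qubit pure states *)

Section TwoQubits.
Variable R : realType.
Local Notation C := R[i].

Lemma adjmxE m n (A : 'M[C]_(m, n)) i j : adjmx A i j = (A j i)^*%C.
Proof. by rewrite !mxE. Qed.

Lemma projectorE n (v : 'cV[C]_n) i j : projector v i j = v i 0 * (v j 0)^*%C.
Proof. by rewrite mxE big_ord1 adjmxE. Qed.

Lemma normc_sqr (z : C) : (Normc.normc z ^+ 2)%:C = z * z^*%C.
Proof. by rewrite -sqr_normc rmorphXn. Qed.

Lemma sqnormE n (v : 'cV[C]_n) : (sqnorm v)%:C = \sum_i v i 0 * (v i 0)^*%C.
Proof. by rewrite rmorph_sum; apply: eq_bigr => i _; exact: normc_sqr. Qed.

Definition i00 : 'I_(2 * 2) := mxtens_index (0, 0).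
Definition i01 : 'I_(2 * 2) := mxtens_index (0, 1).
Definition i10 : 'I_(2 * 2) := mxtens_index (1, 0).
Definition i11 : 'I_(2 * 2) := mxtens_index (1, 1).

Lemma big_qubits (V : nmodType) (F : 'I_(2 * 2) -> V) :
  \sum_i F i = F i00 + F i01 + F i10 + F i11.
Proof.
rewrite !big_ord_recl big_ord0 addr0 -!addrA.
by congr (F _ + (F _ + (F _ + F _))); apply: val_inj.
Qed.

Lemma ord2_1 : lift ord0 ord0 = 1 :> 'I_2.
Proof. exact: val_inj. Qed.

Lemma big_ord2 (V : nmodType) (F : 'I_2 -> V) : \sum_i F i = F 0 + F 1.
Proof. by rewrite big_ord_recl big_ord1 ord2_1. Qed.

Lemma det_mx2 (A : 'M[C]_2) : \det A = A 0 0 * A 1 1 - A 0 1 * A 1 0.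
Proof.
rewrite (expand_det_row _ 0) big_ord2 /cofactor !det_mx11 !mxE.
rewrite expr0 mul1r expr1 mulN1r mulrN ord2_1.
rewrite (_ : lift 1 0 = 0)//; exact: val_inj.
Qed.

(** * Entropy of a qubit state from its trace and determinant *)

Lemma vn_entropyE n (rho : 'M[C]_n) : rho \is hermsymmx ->
  vn_entropy rho = - \sum_i (let r := complex.Re (spectral_diag rho 0 i) in r * log2 r).
Proof.
move=> rhoH.
have /orthomx_spectralP rhoE := hermitian_normalmx rhoH.
have /mxOverP dR := hermitian_spectral_diag_real rhoH.
rewrite /vn_entropy /log2mx; congr (- _).
set P := spectralmx rho in rhoE *; set d := spectral_diag rho in rhoE dR *.
have Pu : P \in unitmx := spectral_unit rho.
rewrite [X in X *m _]rhoE -!mulmxA (mulmxA P) mulmxV// mul1mx mxtrace_mulC.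
rewrite -!mulmxA mulmxV// mulmx1 mulmx_diag mxtrace_diag raddf_sum/=.
apply: eq_bigr => i _; rewrite !mxE.
have /complex_realP[r ->] := dR 0 i.
by rewrite -rmorphM.
Qed.

Lemma spectral_trace n (rho : 'M[C]_n) : rho \is normalmx ->
  \tr rho = \sum_i spectral_diag rho 0 i.
Proof.
move=> /orthomx_spectralP rhoE; rewrite {1}rhoE mxtrace_mulC mulmxA.
by rewrite mulmxV ?mul1mx ?mxtrace_diag// spectral_unit.
Qed.

Lemma spectral_det n (rho : 'M[C]_n) : rho \is normalmx ->
  \det rho = \prod_i spectral_diag rho 0 i.
Proof.
move=> /orthomx_spectralP rhoE; rewrite {1}rhoE !det_mulmx mulrAC -det_mulmx.
by rewrite mulVmx ?det1 ?mul1r ?det_diag// spectral_unit.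
Qed.

(** Trace and determinant are the sum and product of the two real eigenvalues. Sum 1 and nonnegative
    product force both to be nonnegative. *)
Lemma qubit_entropy (rho : 'M[C]_2) (delta : R) : rho \is hermsymmx ->
  \tr rho = 1 -> \det rho = delta%:C -> 0 <= delta ->
  exists a b, [/\ 0 <= a, 0 <= b, a + b = 1, a * b = delta &
    vn_entropy rho = bin_ent a b / ln 2].
Proof.
move=> rhoH tr1 detE delta0; have rhoN := hermitian_normalmx rhoH.
have /mxOverP dR := hermitian_spectral_diag_real rhoH.
move: tr1 detE; rewrite spectral_trace// spectral_det// vn_entropyE//.
rewrite !big_ord_recl !big_ord0 !addr0 mulr1.
have /complex_realP[a ->] := dR 0 0.
have /complex_realP[b ->] := dR 0 (lift ord0 ord0).
rewrite -rmorphD -rmorphM => /complexI ab1 /complexI abE.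
have a0 : 0 <= a by nra.
have b0 : 0 <= b by nra.
exists a, b; split => //=.
by rewrite /bin_ent /log2; ring.
Qed.

(** For a unit vector, the modulus is half the concurrence. *)
Definition detv (phi : 'cV[C]_(2 * 2)) : C :=
  phi i00 0 * phi i11 0 - phi i01 0 * phi i10 0.

(** If [M] is the coefficient matrix of [phi], the reduced state is [M] times its adjoint: it is
    Hermitian, with trace [sqnorm phi] and determinant the squared modulus of [detv phi]. *)
Lemma entanglementE (phi : 'cV[C]_(2 * 2)) : sqnorm phi = 1 ->
  exists a b, [/\ 0 <= a, 0 <= b, a + b = 1, Num.sqrt (a * b) = Normc.normc (detv phi) &
    entanglement phi = bin_ent a b / ln 2].
Proof.
move=> phi1.
have rE a a' : ptraceB (projector phi) a a' =
  phi (mxtens_index (a, 0)) 0 * (phi (mxtens_index (a', 0)) 0)^*%C +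
  phi (mxtens_index (a, 1)) 0 * (phi (mxtens_index (a', 1)) 0)^*%C.
  by rewrite mxE big_ord2 !projectorE.
have [||||a [b [a0 b0 ab1 abE eE]]] := @qubit_entropy (ptraceB (projector phi))
    (Normc.normc (detv phi) ^+ 2).
- apply/is_hermitianmxP; rewrite expr0 scale1r; apply/matrixP => a a'.
  rewrite [RHS]mxE [in RHS]mxE !rE. rewrite rmorphD !rmorphM.
  by congr (_ + _); rewrite mulrC; congr (_ * _); exact: (esym (conjcK _)).
- rewrite /mxtrace big_ord2 !rE.
  transitivity ((sqnorm phi)%:C); last by rewrite phi1.
  rewrite sqnormE.
  by rewrite big_qubits /i00; rewrite -!addrA.
- rewrite det_mx2 !rE normc_sqr /detv.
  rewrite rmorphB !rmorphM /i00 /i01 /i10 /i11.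
  by ring.
- by rewrite sqr_ge0.
exists a, b; split => //; rewrite abE sqrtr_sqr ger0_norm//.
by rewrite /Normc.normc; case: (detv phi) => *; exact: sqrtr_ge0.
Qed.

Lemma entanglement_tangent (phi0 : 'cV[C]_(2 * 2)) (c0 : R) :
  sqnorm phi0 = 1 -> Normc.normc (detv phi0) = c0 ->
  exists m, forall (phi : 'cV[C]_(2 * 2)) (c : R),
    sqnorm phi = 1 -> Normc.normc (detv phi) = c ->
    entanglement phi0 + m * (c - c0) <= entanglement phi.
Proof.
move=> /entanglementE[a0 [b0 [a0_ge0 b0_ge0 ab0 <- ->]]] <-.
have ln2_gt0 : 0 < ln 2 :> R by rewrite ln_gt0// ltr1n.
have [m mP] := bin_ent_tangent a0_ge0 b0_ge0 ab0.
(* The factor 2 passes from the concurrence to the modulus of [detv], and [ln 2] from nats to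
   bits. *)
exists (m * 2 / ln 2) => phi c /entanglementE[a [b [a_ge0 b_ge0 ab <- ->]]] <-.
rewrite mulrAC -mulrDl ler_pM2r ?invr_gt0// -mulrA mulrBr.
exact: mP.
Qed.

(** At equal determinant moduli the linear term of each supporting line vanishes; the lines at [phi]
    and at [psi] give the two inequalities. *)
Lemma entanglement_detv (phi psi : 'cV[C]_(2 * 2)) (c : R) :
  sqnorm phi = 1 -> sqnorm psi = 1 ->
  Normc.normc (detv phi) = c -> Normc.normc (detv psi) = c ->
  entanglement phi = entanglement psi.
Proof.
move=> phi1 psi1 phic psic.
have [m mP] := entanglement_tangent phi1 phic.
have [m' m'P] := entanglement_tangent psi1 psic.
move: (mP _ _ psi1 psic) (m'P _ _ phi1 phic).
move: (entanglement phi) (entanglement psi) => x y.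
by rewrite subrr !mulr0 !addr0 => le1 le2; apply/eqP; rewrite eq_le le1.
Qed.

(** * Choi states and Kraus vectors *)

Lemma tens_ketE (a b : 'I_2) (i j : 'I_2) :
  ((ket R i *t ket R j) : 'cV[C]_(2 * 2)) (mxtens_index (a, b)) 0 = (a == i)%:R * (b == j)%:R.
Proof.
(* The product has [1 * 1] columns, so its column index is rewritten as a pair before [tensmxE]
   applies. *)
transitivity ((ket R i *t ket R j) (mxtens_index (a, b)) (mxtens_index (0, 0))).
  by congr (fun_of_matrix _ _ _); exact: val_inj.
by rewrite tensmxE !mxE !eqxx !andbT.
Qed.

Lemma omegaE (a b : 'I_2) : omega R (mxtens_index (a, b)) 0 = (Num.sqrt 2)^-1%:C * (a == b)%:R.
Proof.
rewrite mxE mxE !tens_ketE; congr (_ * _).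
by case: a b => [[|[|]]// ?] [[|[|]]// ?]; rewrite /= ?(mulr0, mulr1, addr0, add0r).
Qed.

Lemma ord2P (b : 'I_2) : b = 0 \/ b = 1.
Proof. by case: b => [[|[|]]// ?]; [left|right]; exact: val_inj. Qed.

Lemma kraus_vecE (K : 'M[C]_2) a b :
  kraus_vec K (mxtens_index (a, b)) 0 = (Num.sqrt 2)^-1%:C * K a b.
Proof.
rewrite mxE big_qubits /i00 /i01 /i10 /i11 !tensmxE !omegaE !mxE.
by case: (ord2P b) => ->; rewrite /= ?(mulr0, mulr1, mul0r, addr0, add0r) mulrC.
Qed.

Lemma conjc_realM (r : R) (z : C) : (r%:C * z)^*%C = r%:C * z^*%C.
Proof. by rewrite rmorphM /= oppr0. Qed.

Lemma sqrt2V_sqr : (Num.sqrt 2)^-1 * (Num.sqrt 2)^-1 = 2^-1 :> R.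
Proof. by rewrite -invfM -expr2 sqr_sqrtr. Qed.

Lemma choiE (N : 'M[C]_2 -> 'M[C]_2) a b a' b' :
  choi N (mxtens_index (a, b)) (mxtens_index (a', b')) = N ((2^-1)%:C *: delta_mx b b') a a'.
Proof.
have XE c c' : \matrix_(x, x') projector (omega R) (mxtens_index (x, c)) (mxtens_index (x', c'))
   = (2^-1)%:C *: delta_mx c c' :> 'M[C]_2.
  apply/matrixP => x x'; rewrite mxE projectorE !omegaE !mxE conjc_realM.
  rewrite mulrACA -rmorphM/= sqrt2V_sqr; congr (_ * _).
  by case: (x == c); case: (x' == c'); rewrite /= ?(mul0r, mul1r) ?oppr0.
rewrite /choi /tens_id summxE (bigD1 b)//= summxE (bigD1 b')//= tensmxE XE [delta_mx _ _ _ _]mxE.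
rewrite !eqxx mulr1 big1 ?addr0; last first.
  by move=> c cb; rewrite tensmxE [delta_mx _ _ _ _]mxE (eq_sym b') (negPf cb) andbF mulr0.
rewrite big1 ?addr0// => c cb; rewrite summxE big1// => c' _.
by rewrite tensmxE [delta_mx _ _ _ _]mxE (eq_sym b) (negPf cb) mulr0.
Qed.

(** Both sides have as entry at [(a, b), (a', b')] half the sum over [i] of [K i a b] times the
    conjugate of [K i a' b']. This is how a Kraus decomposition yields an ensemble for the Choi
    state. *)
Lemma choi_kraus k (K : 'I_k -> 'M[C]_2) :
  choi (kraus_map K) = \sum_(i < k) projector (kraus_vec (K i)).
Proof.
apply/matrixP => x y; case: (mxtens_indexP x) => a b; case: (mxtens_indexP y) => a' b'.
rewrite choiE !summxE; apply: eq_bigr => i _.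
rewrite projectorE !kraus_vecE -scalemxAr -scalemxAl mxE conjc_realM mulrACA -rmorphM/= sqrt2V_sqr.
congr (_ * _); rewrite mxE (bigD1 b')//= adjmxE big1 ?addr0.
  congr (_ * _); rewrite mxE (bigD1 b)//= mxE !eqxx mulr1 big1 ?addr0//.
  by move=> c cb; rewrite mxE (negPf cb) mulr0.
move=> c cb; rewrite mxE big1 ?mul0r// => d _.
by rewrite mxE (negPf cb) andbF mulr0.
Qed.

(** With [z i] the inner product of the [i]-th ensemble vector with a fixed kernel vector of the
    mixed state, this says that every member of nonzero weight is orthogonal to the kernel. *)
Lemma psum_normc_eq0 k (q : 'I_k -> R) (z : 'I_k -> C) : (forall i, 0 <= q i) ->
  \sum_i (q i)%:C * (z i * (z i)^*%C) = 0 -> forall i, q i != 0 -> z i = 0.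
Proof.
move=> q0 s0 i qi.
have : \sum_i q i * Normc.normc (z i) ^+ 2 = 0.
  apply: complexI; rewrite rmorph_sum -[RHS]s0; apply: eq_bigr => j _.
  by rewrite rmorphM/= normc_sqr.
move/eqP; rewrite psumr_eq0; last by move=> j _; rewrite mulr_ge0 ?sqr_ge0.
move=> /allP/(_ i (mem_index_enum _)); rewrite mulf_eq0 (negPf qi) sqrf_eq0 => /eqP.
exact: Normc.eq0_normc.
Qed.

(** * The amplitude-damping channel *)

Lemma normc_real (r : R) : Normc.normc r%:C = `|r|.
Proof. by rewrite /Normc.normc/= expr0n/= addr0 sqrtr_sqr. Qed.

Lemma conjcB (x y : C) : (x - y)^*%C = x^*%C - y^*%C.
Proof. exact: rmorphB. Qed.

Lemma ensemble_entry d k (q : 'I_k -> R) (phi : 'I_k -> 'cV[C]_d) rho x y :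
  pure_ensemble q phi rho ->
  rho x y = \sum_i (q i)%:C * (phi i x 0 * (phi i y 0)^*%C).
Proof.
by case=> _ _ _ ->; rewrite summxE; apply: eq_bigr => i _; rewrite mxE projectorE.
Qed.

Lemma conjc_amp_damp_kraus (gamma : R) i a b :
  (amp_damp_kraus gamma i a b)^*%C = amp_damp_kraus gamma i a b.
Proof.
rewrite /amp_damp_kraus; case: ifP => _; rewrite mxE;
by case: ifP => _; case: ifP => _; rewrite ?conjc0 ?conjc1 ?conjc_real.
Qed.

Lemma choi_amp_damp (gamma : R) a b a' b' :
  choi (amp_damp gamma) (mxtens_index (a, b)) (mxtens_index (a', b')) =
  (2^-1)%:C * \sum_(i < 2) amp_damp_kraus gamma i a b * amp_damp_kraus gamma i a' b'.
Proof.
rewrite choi_kraus summxE mulr_sumr; apply: eq_bigr => i _.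
by rewrite projectorE !kraus_vecE conjc_realM conjc_amp_damp_kraus mulrACA -rmorphM/= sqrt2V_sqr.
Qed.

Lemma amp_damp_concurrence (gamma : R) k (q : 'I_k -> R)
    (phi : 'I_k -> 'cV[C]_(2 * 2)) :
  pure_ensemble q phi (choi (amp_damp gamma)) ->
  \sum_i q i * Normc.normc (detv (phi i)) = Num.sqrt (1 - gamma) / 2.
Proof.
move=> ens; have [q0 _ _ _] := ens.
set s := Num.sqrt (1 - gamma).
have E x y := ensemble_entry x y ens.
(* Both Kraus operators have a zero lower left entry, so the diagonal entry of the Choi state at
   [|10>] vanishes. *)
have phi10 : forall i, q i != 0 -> phi i i10 0 = 0.
  apply: psum_normc_eq0 => //; rewrite -E choi_amp_damp big_ord2 !mxE /=.
  by rewrite !mulr0 addr0 mulr0.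
(* A second kernel vector is [|11> - s |00>]: the quadratic form of the Choi state on it, expanded
   into four entries, is 0. *)
have phi11 : forall i, q i != 0 -> phi i i11 0 - s%:C * phi i i00 0 = 0.
  apply: psum_normc_eq0 => //.
  transitivity (choi (amp_damp gamma) i11 i11 - s%:C * choi (amp_damp gamma) i11 i00
     - s%:C * choi (amp_damp gamma) i00 i11 + s%:C * (s%:C * choi (amp_damp gamma) i00 i00)).
    rewrite !E !mulr_sumr -!sumrB -big_split; apply: eq_bigr => i _ /=.
    by rewrite conjcB conjc_realM; ring.
  rewrite !choi_amp_damp !big_ord2 !mxE /= -/s.
  by ring.
have E00 : \sum_i q i * Normc.normc (phi i i00 0) ^+ 2 = 2^-1.
  apply: complexI; rewrite rmorph_sum.
  transitivity (choi (amp_damp gamma) i00 i00).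
    by rewrite E; apply: eq_bigr => i _; rewrite rmorphM/= normc_sqr.
  rewrite choi_amp_damp big_ord2 !mxE /=.
  by ring.
rewrite -E00 mulr_sumr; apply: eq_bigr => i _.
(* Vectors of weight zero are unconstrained but contribute nothing to either sum. *)
have [->|qi] := eqVneq (q i) 0; first by rewrite !mul0r mulr0.
rewrite /detv phi10// mulr0 subr0 (_ : phi i i11 0 = s%:C * phi i i00 0); last first.
  by apply/eqP; rewrite -subr_eq0 phi11.
rewrite mulrCA !Normc.normcM normc_real ger0_norm ?sqrtr_ge0//.
by rewrite mulrCA expr2.
Qed.

Lemma kraus_prob_sum (K : 'M[C]_2) : kraus_prob K =
  2^-1 * (Normc.normc (K 0 0) ^+ 2 + Normc.normc (K 0 1) ^+ 2
        + Normc.normc (K 1 0) ^+ 2 + Normc.normc (K 1 1) ^+ 2).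
Proof.
have h : Normc.normc (Num.sqrt 2)^-1%:C ^+ 2 = 2^-1 :> R.
  by rewrite normc_real real_normK ?num_real// expr2 sqrt2V_sqr.
rewrite /kraus_prob /sqnorm big_qubits !kraus_vecE !Normc.normcM !exprMn h.
by rewrite -!mulrDr.
Qed.

(** Normalising multiplies by [sqrt 2], which cancels the factor [1 / sqrt 2] of [omega]; the
    coefficient matrix of the state is then [K] itself. *)
Lemma kraus_state_half (K : 'M[C]_2) a b : kraus_prob K = 2^-1 ->
  kraus_state K (mxtens_index (a, b)) 0 = K a b.
Proof.
move=> pK; rewrite mxE kraus_vecE pK mulrA -rmorphM/=.
rewrite sqrtrV// invrK divff ?mul1r// gt_eqF//.
by rewrite sqrtr_gt0.
Qed.

Lemma kraus_vec_half (K : 'M[C]_2) : kraus_prob K = 2^-1 ->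
  (kraus_prob K)%:C *: projector (kraus_state K) = projector (kraus_vec K).
Proof.
move=> pK; apply/matrixP => x y.
case: (mxtens_indexP x) => a b; case: (mxtens_indexP y) => a' b'.
rewrite mxE !projectorE !kraus_state_half// !kraus_vecE conjc_realM mulrACA -rmorphM/=.
by rewrite sqrt2V_sqr pK.
Qed.

Lemma sqnorm_kraus_state (K : 'M[C]_2) : kraus_prob K = 2^-1 -> sqnorm (kraus_state K) = 1.
Proof.
move=> pK; rewrite /sqnorm big_qubits !kraus_state_half//.
by apply: (@mulfI _ 2^-1); rewrite ?invr_eq0 ?pnatr_eq0// -kraus_prob_sum pK mulr1.
Qed.

(** * Mixing two Kraus operators by the Hadamard matrix *)

Lemma adjmxD m n (A B : 'M[C]_(m, n)) : adjmx (A + B) = adjmx A + adjmx B.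
Proof. by apply/matrixP => i j; rewrite [RHS]mxE !adjmxE mxE rmorphD. Qed.

Lemma adjmxB m n (A B : 'M[C]_(m, n)) : adjmx (A - B) = adjmx A - adjmx B.
Proof. by apply/matrixP => i j; rewrite adjmxE !mxE conjcB. Qed.

Lemma adjmxZ m n (r : R) (A : 'M[C]_(m, n)) : adjmx (r%:C *: A) = r%:C *: adjmx A.
Proof. by apply/matrixP => i j; rewrite [RHS]mxE !adjmxE mxE conjc_realM. Qed.

Lemma scalemxE m n (c : C) (A : 'M[C]_(m, n)) i j : (c *: A) i j = c * A i j.
Proof. by rewrite mxE. Qed.

Lemma mx2E (a b c d : C) : (mx2 a b c d 0 0 = a) * (mx2 a b c d 0 1 = b) *
  (mx2 a b c d 1 0 = c) * (mx2 a b c d 1 1 = d).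
Proof. by rewrite !mxE. Qed.

Definition hadamard : 'M[C]_2 := (Num.sqrt (2 : R))^-1%:C *: mx2 1 1 1 (-1).

Lemma hadamard0 (K : 'I_2 -> 'M[C]_2) :
  kraus_mix hadamard K 0 = (Num.sqrt 2)^-1%:C *: (K 0 + K 1).
Proof. by rewrite /kraus_mix big_ord2 !mxE /= !mulr1 scalerDr. Qed.

Lemma hadamard1 (K : 'I_2 -> 'M[C]_2) :
  kraus_mix hadamard K 1 = (Num.sqrt 2)^-1%:C *: (K 0 - K 1).
Proof. by rewrite /kraus_mix big_ord2 !mxE /= mulr1 mulrN1 scaleNr scalerBr. Qed.

(** Here [a] and [d] stand for the diagonal products of two Kraus operators, [b] and [c] for the
    cross terms, which cancel. The identity serves both the action of the channel and trace
    preservation. *)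
Lemma half_polarization (V : lmodType C) (a b c d : V) :
  (2^-1)%:C *: (a + b + (c + d)) + (2^-1)%:C *: (a - b - (c - d)) = a + d.
Proof.
rewrite -scalerDr; have -> : a + b + (c + d) + (a - b - (c - d)) = 2%:R *: (a + d).
  rewrite scaler_nat mulr2n opprB addrACA (addrACA a b) subrr addr0.
  by rewrite (addrC c) (addrACA d c) subrr addr0 addrACA.
rewrite scalerA (_ : _ * _ = 1) ?scale1r//.
by rewrite -(rmorph_nat (real_complex R)) -rmorphM/= mulVf// pnatr_eq0.
Qed.

Lemma kraus_map_hadamard (K : 'I_2 -> 'M[C]_2) : kraus_map (kraus_mix hadamard K) =1 kraus_map K.
Proof.
move=> rho; rewrite /kraus_map !big_ord2 hadamard0 hadamard1 !adjmxZ adjmxD adjmxB.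
rewrite -!scalemxAl -!scalemxAr !scalerA -!rmorphM/= sqrt2V_sqr.
by rewrite !mulmxBl !mulmxBr !mulmxDl !mulmxDr half_polarization.
Qed.

Lemma kraus_tp_hadamard (K : 'I_2 -> 'M[C]_2) :
  \sum_(i < 2) adjmx (kraus_mix hadamard K i) *m kraus_mix hadamard K i =
  \sum_(i < 2) adjmx (K i) *m K i.
Proof.
rewrite !big_ord2 hadamard0 hadamard1 !adjmxZ adjmxD adjmxB.
rewrite -!scalemxAl -!scalemxAr !scalerA -!rmorphM/= sqrt2V_sqr.
by rewrite !mulmxBl !mulmxBr !mulmxDl !mulmxDr half_polarization.
Qed.

Lemma amp_damp_tp (gamma : R) : 0 <= gamma <= 1 ->
  \sum_(i < 2) adjmx (amp_damp_kraus gamma i) *m amp_damp_kraus gamma i = 1%:M.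
Proof.
move=> /andP[g0 g1].
have sg : Num.sqrt gamma * Num.sqrt gamma = gamma by rewrite -expr2 sqr_sqrtr.
have s1g : Num.sqrt (1 - gamma) * Num.sqrt (1 - gamma) = 1 - gamma.
  by rewrite -expr2 sqr_sqrtr// subr_ge0.
apply/matrixP => i j; rewrite big_ord2 mxE !(mxE _ _ i j) !big_ord2 !adjmxE.
rewrite !conjc_amp_damp_kraus.
case: (ord2P i) => ->; case: (ord2P j) => ->; rewrite !mxE /= ?(mul0r, mulr0, mul1r, mulr1, addr0, add0r)//.
by rewrite -!rmorphM/= sg s1g -rmorphD/= subrK.
Qed.

(** The sign [e] treats both mixed operators at once. It affects neither the squared moduli of the
    entries nor the determinant, the matrix being upper triangular. *)
Lemma hadamard_amp_dampE (gamma : R) (i : 'I_2) : exists2 e : R, e ^+ 2 = 1 &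
  kraus_mix hadamard (amp_damp_kraus gamma) i = (Num.sqrt 2)^-1%:C *:
    mx2 1 (e * Num.sqrt gamma)%:C 0 (Num.sqrt (1 - gamma))%:C.
Proof.
case: (ord2P i) => ->; [exists 1|exists (-1)]; rewrite ?expr1n ?sqrrN ?expr1n//.
  rewrite hadamard0; congr (_ *: _); apply/matrixP => a b; rewrite !mxE /=.
  by case: ifP => _; case: ifP => _; rewrite ?mul1r ?addr0 ?add0r.
rewrite hadamard1; congr (_ *: _); apply/matrixP => a b; rewrite !mxE /=.
by case: ifP => _; case: ifP => _; rewrite ?mulN1r ?rmorphN ?subr0 ?sub0r ?oppr0.
Qed.

Lemma hadamard_prob (gamma : R) (i : 'I_2) : 0 <= gamma <= 1 ->
  kraus_prob (kraus_mix hadamard (amp_damp_kraus gamma) i) = 2^-1.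
Proof.
move=> /andP[g0 g1]; have [e e2 ->] := hadamard_amp_dampE gamma i.
have g1' : 0 <= 1 - gamma by rewrite subr_ge0.
rewrite kraus_prob_sum !scalemxE !mx2E !Normc.normcM !exprMn !normc_real.
rewrite normr0 normr1 !real_normK ?num_real// exprMn e2 !sqr_sqrtr// expr2 sqrt2V_sqr.
by field.
Qed.

Lemma hadamard_detv (gamma : R) (i : 'I_2) : 0 <= gamma <= 1 ->
  Normc.normc (detv (kraus_state (kraus_mix hadamard (amp_damp_kraus gamma) i)))
    = Num.sqrt (1 - gamma) / 2.
Proof.
move=> g01; rewrite /detv !kraus_state_half ?hadamard_prob//.
have [e _ ->] := hadamard_amp_dampE gamma i.
rewrite !scalemxE !mx2E !mulr0 subr0 mulr1 !Normc.normcM !normc_real.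
have h : 0 <= (Num.sqrt 2)^-1 :> R by rewrite invr_ge0 sqrtr_ge0.
by rewrite !ger0_norm ?sqrtr_ge0// mulrA sqrt2V_sqr mulrC.
Qed.

Lemma choi_ext (N N' : 'M[C]_2 -> 'M[C]_2) : N =1 N' -> choi N = choi N'.
Proof. by move=> NN'; rewrite (funext NN'). Qed.

Lemma hadamard_ensemble (gamma : R) : 0 <= gamma <= 1 ->
  let K := kraus_mix hadamard (amp_damp_kraus gamma) in
  pure_ensemble (fun i => kraus_prob (K i)) (fun i => kraus_state (K i))
    (choi (amp_damp gamma)).
Proof.
move=> g01 K; have p i : kraus_prob (K i) = 2^-1 by exact: hadamard_prob.
split=> [i||i|].
- by rewrite p invr_ge0 ler0n.
- by rewrite big_ord2 !p; field.
- exact: sqnorm_kraus_state.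
- rewrite -(choi_ext (kraus_map_hadamard (amp_damp_kraus gamma))) choi_kraus.
  by apply: eq_bigr => i _; rewrite kraus_vec_half.
Qed.

(** Equal determinant moduli make the two entanglements equal, and the two weights add up to 1. *)
Lemma entanglement_average (K : 'I_2 -> 'M[C]_2) (c : R) :
  (forall i, kraus_prob (K i) = 2^-1) ->
  (forall i, Normc.normc (detv (kraus_state (K i))) = c) ->
  \sum_(i < 2) kraus_prob (K i) * entanglement (kraus_state (K i)) =
  entanglement (kraus_state (K 0)).
Proof.
move=> prob conc.
have norm1 i := sqnorm_kraus_state (prob i).
have E i := entanglement_detv (norm1 i) (norm1 0) (conc i) (conc 0).
under eq_bigr => i _ do rewrite E prob.
by rewrite big_ord2 -mulrDl; move: (entanglement _) => x; field.
Qed.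

Lemma EoF_amp_damp_le (gamma : R) (psi : 'cV[C]_(2 * 2)) k (q : 'I_k -> R)
    (phi : 'I_k -> 'cV[C]_(2 * 2)) :
  sqnorm psi = 1 -> Normc.normc (detv psi) = Num.sqrt (1 - gamma) / 2 ->
  pure_ensemble q phi (choi (amp_damp gamma)) ->
  entanglement psi <= \sum_i q i * entanglement (phi i).
Proof.
move=> psi1 psid ens; have [m mP] := entanglement_tangent psi1 psid.
have := amp_damp_concurrence ens; have [q_ge0 q_sum phi1 _] := ens.
move: mP {psid}; set c0 := Num.sqrt _ / 2; set E0 := entanglement psi => mP cE.
(* Jensen's inequality: averaging the supporting line at [psi] over the ensemble leaves [E0],
   because the determinant moduli average to [c0]. *)
have -> : E0 = \sum_i q i * (E0 + m * (Normc.normc (detv (phi i)) - c0)).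
  under eq_bigr do rewrite mulrDr mulrCA mulrBr.
  rewrite big_split /= -mulr_suml q_sum mul1r -mulr_sumr sumrB cE -mulr_suml q_sum.
  by rewrite mul1r subrr mulr0 addr0.
by apply: ler_sum => i _; rewrite ler_wpM2l// mP.
Qed.

End TwoQubits.

Theorem proposition9 (R : realType) (gamma : R) (hgamma : 0 <= gamma <= 1) :
  let U : 'M[R[i]]_2 := (Num.sqrt (2 : R))^-1%:C *: mx2 1 1 1 (-1) in
  let K := kraus_mix U (amp_damp_kraus gamma) in
  kraus_decomposition K (amp_damp gamma) /\ choi_optimal K (amp_damp gamma).
Proof.
rewrite /= -/(hadamard R); split.
  split=> [|rho]; first by rewrite kraus_tp_hadamard amp_damp_tp.
  by rewrite kraus_map_hadamard.
pose K := kraus_mix (hadamard R) (amp_damp_kraus gamma).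
have prob i : kraus_prob (K i) = 2^-1 by exact: hadamard_prob.
have norm1 i : sqnorm (kraus_state (K i)) = 1 by exact: sqnorm_kraus_state.
have conc i : Normc.normc (detv (kraus_state (K i))) = Num.sqrt (1 - gamma) / 2.
  exact: hadamard_detv.
have ens := hadamard_ensemble hgamma.
rewrite /choi_optimal /EoF; set S := (X in inf X).
set e0 := \sum_(i < 2) _.
have e0E : e0 = entanglement (kraus_state (K 0)).
  exact: (entanglement_average prob conc).
have lb : lbound S e0.
  move=> _ [k [q [phi [qphi ->]]]]; rewrite e0E.
  exact: EoF_amp_damp_le (norm1 0) (conc 0) qphi.
have Se0 : S e0 by exists 2, (fun i => kraus_prob (K i)), (fun i => kraus_state (K i)).
(* As a lower bound that belongs to [S], [e0] is its infimum. Membership supplies the non-emptiness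
   for one inequality, and [lb] the boundedness for the other. *)
apply/eqP; rewrite eq_le; apply/andP; split.
  by apply: lb_le_inf => //; exists e0.
by apply: ge_inf => //; exists e0.
Qed.
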